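(* Let $f:\mathbb{R}^d\to\mathbb{R}\cup\{+\infty\}$ be a lower semicontinuous quasiconvex function which is continuous on the interior of its domain and which is locally Lipschitz on an open set $\mathcal{O}\subset\operatorname{dom} f$. Assume further that $f$ satisfies the following three hypotheses: (a) $f$ is coercive and $\operatorname{int}[f\le\alpha]\neq\emptyset$ for every $\alpha>\inf f$; (b) for every $x\in\operatorname{dom} f\setminus\operatorname{argmin} f$ there exist $\delta,\ell>0$ such that $|\nabla f|(y)>\ell$ for all $y\in B(x,\delta)\cap\operatorname{dom} f$; (c) for every $\alpha\in(\inf f,\sup f)$ there exist $\eta,r>0$ such that for every $\beta\in(\alpha-\eta,\alpha+\eta)$ the set $\mathbb{R}^d\setminus\operatorname{int}([f\le\beta])$ is $r$-prox-regular. Then, for (Lebesgue) almost every $x\in\mathcal{O}$, the function $f$ admits a steepest descent curve emanating from $x$.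
   Context: $\mathbb{R}^d$ carries the Euclidean norm; $B(x,\delta)$ is the open ball. $\operatorname{dom} f=\{x: f(x)<+\infty\}$ and $[f\le\alpha]=\{x\in\mathbb{R}^d: f(x)\le\alpha\}$. $f$ is quasiconvex if $f(tx+(1-t)y)\le\max\{f(x),f(y)\}$ for all $x,y\in\mathbb{R}^d$, $t\in[0,1]$ (equivalently, all sublevel sets are convex). $f$ is coercive if $[f\le\alpha]$ is compact for every $\alpha<\sup f$. Metric slope: $|\nabla f|(x)=\limsup_{y\to x}\frac{(f(x)-f(y))^+}{\|x-y\|}$ if $x\in\operatorname{dom} f$, and $|\nabla f|(x)=+\infty$ otherwise, where $a^+=\max\{a,0\}$. A closed set $S\subset\mathbb{R}^d$ is $r$-prox-regular ($r>0$) if every $u\in\mathbb{R}^d$ with $d(u,S)<r$ has a unique nearest point in $S$ (so that $\operatorname{proj}_S$ is well defined on the open set $\{u: d(u,S)<r\}$). A steepest descent curve of $f$ emanating from $x_0$ is a $1$-Lipschitz curve $x:[0,T]\to\mathbb{R}^d$ (for some $T>0$) with $x(0)=x_0$ and $(f\circ x)'(t)=-|\nabla f|(x(t))$ for a.e. $t\in[0,T]$. *)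

(* Defs.v *)
From HB Require Import structures.
From mathcomp Require Import all_boot all_order all_algebra.
From mathcomp Require Import all_classical all_reals all_analysis.

Set Implicit Arguments.
Unset Strict Implicit.
Unset Printing Implicit Defensive.

Import Order.TTheory GRing.Theory Num.Theory.
Import numFieldNormedType.Exports.

Local Open Scope classical_set_scope.
Local Open Scope ring_scope.

(* The library norm on 'rV[R]_d is the sup norm. It induces the usual topology,
   so topological notions are the library's, but every metric notion below is
   written with the Euclidean norm. *)
Definition enorm (R : realType) (d : nat) (v : 'rV[R]_d) : R :=
  Num.sqrt (\sum_(i < d) v ord0 i ^+ 2).

Definition eball (R : realType) (d : nat) (x : 'rV[R]_d) (r : R) :
  set 'rV[R]_d := [set y | enorm (y - x) < r].

(* d(u, S), with the convention d(u, set0) = +oo *)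
Definition dist_set (R : realType) (d : nat) (u : 'rV[R]_d)
    (S : set 'rV[R]_d) : \bar R :=
  ereal_inf [set (enorm (u - s))%:E | s in S].

Definition prox_regular (R : realType) (d : nat) (r : R)
    (S : set 'rV[R]_d) : Prop :=
  closed S /\
  forall u : 'rV[R]_d, (dist_set u S < r%:E)%E ->
    exists! p : 'rV[R]_d, S p /\ (enorm (u - p))%:E = dist_set u S.

Definition dom (R : realType) (d : nat) (f : 'rV[R]_d -> \bar R) :
  set 'rV[R]_d := [set x | (f x < +oo)%E].

Definition sublevel (R : realType) (d : nat) (f : 'rV[R]_d -> \bar R)
    (a : R) : set 'rV[R]_d := [set x | (f x <= a%:E)%E].

Definition argmin (R : realType) (d : nat) (f : 'rV[R]_d -> \bar R) :
  set 'rV[R]_d := [set x | forall y, (f x <= f y)%E].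

Definition inf_fun (R : realType) (d : nat) (f : 'rV[R]_d -> \bar R) : \bar R :=
  ereal_inf (range f).

Definition sup_fun (R : realType) (d : nat) (f : 'rV[R]_d -> \bar R) : \bar R :=
  ereal_sup (range f).

Definition quasiconvex (R : realType) (d : nat) (f : 'rV[R]_d -> \bar R) :
    Prop :=
  forall (x y : 'rV[R]_d) (t : R), 0 <= t <= 1 ->
    (f (t *: x + (1 - t) *: y)%R <= maxe (f x) (f y))%E.

Definition coercive (R : realType) (d : nat) (f : 'rV[R]_d -> \bar R) : Prop :=
  forall a : R, (a%:E < sup_fun f)%E -> compact (sublevel f a).

(* Meant for O `<=` dom f, where fine (f y) is the actual value of f. *)
Definition locally_lipschitz_on (R : realType) (d : nat)
    (f : 'rV[R]_d -> \bar R) (O : set 'rV[R]_d) : Prop :=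
  forall x, O x -> exists delta L : R, 0 < delta /\
    forall y z, O y -> O z -> eball x delta y -> eball x delta z ->
      `|fine (f y) - fine (f z)| <= L * enorm (y - z).

(* The limsup is over the punctured neighbourhoods of x. For finite f x, the
   quotient is 0 where f y = +oo. *)
Definition slope (R : realType) (d : nat) (f : 'rV[R]_d -> \bar R)
    (x : 'rV[R]_d) : \bar R :=
  if (f x < +oo)%E then
    limf_esup
      (fun y => (maxe (f x - f y) 0 * ((enorm (x - y))^-1)%R%:E)%E) x^'
  else +oo%E.

(* g'(t) = l for an extended real-valued g; l is forced to be finite. *)
Definition has_derivative_at (R : realType) (g : R -> \bar R) (t : R)
    (l : \bar R) : Prop :=
  [/\ \forall s \near t, g s \is a fin_num,
      derivable (fine \o g) t 1 &
      (derive1 (fine \o g) t)%:E = l].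

(* A curve [0, T] -> R^d is represented by a function c on R constrained only
   on [0, T]: the values elsewhere can affect the derivative only at t = 0 and
   t = T, which form a null set. *)
Definition steepest_descent_curve (R : realType) (d : nat)
    (f : 'rV[R]_d -> \bar R) (x0 : 'rV[R]_d) (T : R) (c : R -> 'rV[R]_d) :
    Prop :=
  [/\ forall s t : R, s \in `[0, T] -> t \in `[0, T] ->
        enorm (c s - c t) <= `|s - t|,
      c 0 = x0 &
      {ae (@lebesgue_measure R), forall t : R, t \in `[0, T] ->
         has_derivative_at (f \o c) t (- slope f (c t))%E}].

Definition box (R : realType) (d : nat) (a b : 'rV[R]_d) : set 'rV[R]_d :=
  [set x | forall i : 'I_d, a ord0 i <= x ord0 i <= b ord0 i].

Definition box_volume (R : realType) (d : nat) (a b : 'rV[R]_d) : R :=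
  \prod_(i < d) Num.max 0 (b ord0 i - a ord0 i).

(* d-dimensional Lebesgue outer measure; the library only has the Lebesgue
   measure of the line. *)
Definition lebesgue_outer (R : realType) (d : nat) (A : set 'rV[R]_d) : \bar R :=
  ereal_inf [set s | exists a b : nat -> 'rV[R]_d,
    A `<=` \bigcup_k box (a k) (b k) /\
    s = (\sum_(0 <= k <oo) (box_volume (a k) (b k))%:E)%E].

Definition ae_on (R : realType) (d : nat) (O : set 'rV[R]_d)
    (P : 'rV[R]_d -> Prop) : Prop :=
  lebesgue_outer (O `\` [set x | P x]) = 0%E.

(* Main.v *)
Require Import Defs.
From HB Require Import structures.
From mathcomp Require Import all_boot all_order all_algebra.
From mathcomp Require Import all_classical all_reals all_analysis.
From mathcomp Require Import ring lra.

Set Implicit Arguments.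
Unset Strict Implicit.
Unset Printing Implicit Defensive.

Import Order.TTheory GRing.Theory Num.Theory.
Import numFieldNormedType.Exports.

Local Open Scope classical_set_scope.
Local Open Scope ring_scope.


(** Near a point x0 of O that is not a minimizer, each x lies on the boundary of
its sublevel set [f <= f x] (not_interior_sublevel), and prox-regularity of the
complement inscribes in that convex set a ball touching x, of a radius r > 0
independent of x (prox_regular_touching_ball). Ball and convexity determine an
outward unit normal n(x) at x. The normal varies continuously from one level to
the next: a ball inscribed in a smaller sublevel set lies in the half-space that
supports a larger one, which gives r |n(x) - n(y)|^2 <= 2 |x - y|
(ball_normal_holder). Hence the equation c' = - n(c), c(0) = x0, has a solution
c (peano), of unit speed.

Such a curve descends as fast as possible. Let y be close to x = c(t) with
f y < f x. The ball inscribed at y is almost tangent to - n(x), so the curve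
enters it after a time that exceeds |x - y| by an arbitrarily small proportion
only; there f is at most f y. Choosing points y whose difference quotients tend
to the slope of f at x shows that the lower right derivative of f o c at t is at
most minus the slope (descent_along_normal), and the opposite bound holds for
every 1-Lipschitz curve. So the derivative of f o c is minus the slope wherever
it exists (slope_along_curve). Finally f o c is Lipschitz, hence differentiable
almost everywhere: up to an affine term it is the distribution function of an
absolutely continuous measure (lipschitz_ae_derivable).

At a minimizer the slope vanishes and the constant curve is a solution. Thus a
curve starts at every point of O, and the exceptional set is empty. *)

(** * Differentiability of Lipschitz functions of one variable *)

(** Both measures are infima over the same coverings by half-open intervals, so
it suffices to compare the lengths of those intervals. *)
Lemma stieltjes_le_lebesgue (R : realType) (G : cumulative R R) (K : R) :
  0 < K -> (forall s t, s <= t -> G t - G s <= K * (t - s)) ->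
  forall A : set R,
  (lebesgue_stieltjes_measure G A <= K%:E * lebesgue_measure A)%E.
Proof.
move=> K0 GK A; rewrite -lee_pdivrMl//.
apply: le_ereal_inf_tmp => _ [B [mB AB] <-].
rewrite lee_pdivrMl// -nneseriesZl; last first.
  by move=> i _; exact: wlength_ge0.
apply: (@le_trans _ _ (\sum_(k <oo) wlength G (B k))%E).
  by apply: ereal_inf_lbound; exists B.
apply: lee_nneseries => [i _ _|i _]; first exact: wlength_ge0.
have [[a b] _ /= <-] : ocitv (B i) by exact: mB.
have [ab|ba] := leP a b; last first.
  by rewrite set_itv_ge ?wlength0 ?mule0// bnd_simp -leNgt ltW.
by rewrite !wlength_itv_bnd// -EFinM lee_fin GK.
Qed.

(** Adding L t to F t makes it nondecreasing. The Stieltjes measure of the sum is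
dominated by Lebesgue measure, so the sum is the indefinite integral of a
Radon-Nikodym density, to which Lebesgue's differentiation theorem applies. *)
Lemma lipschitz_ae_derivable (R : realType) (F : R -> R) (L a b : R) :
  (forall s t, `|F s - F t| <= L * `|s - t|) ->
  {ae (@lebesgue_measure R), forall t, t \in `]a, b[ -> derivable F t 1}.
Proof.
move=> FL.
have [ba|ab] := leP b a.
  apply: aeW => t; rewrite in_itv/= => /andP[at_ tb].
  by move: (lt_trans at_ tb); rewrite ltNge ba.
have L0 : 0 <= L.
  by have := le_trans (normr_ge0 _) (FL 1 0); rewrite subr0 normr1 mulr1.
pose G t := F t + L * t.
have Gnd : {homo G : s t / s <= t}.
  move=> s t st; rewrite -subr_ge0 /G.
  have := FL s t; rewrite ler_distlC (distrC s) ger0_norm ?subr_ge0//.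
  by move=> /andP[]; nra.
have GK s t : s <= t -> G t - G s <= (2 * L + 1) * (t - s).
  move=> st; rewrite /G.
  have := FL s t; rewrite ler_distlC (distrC s) ger0_norm ?subr_ge0//.
  by move=> /andP[]; nra.
have Fc : continuous F.
  move=> x; apply/cvgrPdist_le => e e0; near=> y.
  apply: le_trans (FL _ _) _.
  apply: (@le_trans _ _ (L * (e / (L + 1)))).
    rewrite ler_wpM2l//; near: y; apply: cvgr_dist_le => //.
    by rewrite divr_gt0// ltr_wpDl.
  rewrite mulrCA; apply: ler_piMr; first exact: ltW.
  by rewrite ler_pdivrMr ?ltr_wpDl// mul1r lerDl.
have Gc : continuous G.
  by move=> x; apply: cvgD; [exact: Fc|apply: cvgMr; exact: cvg_id].
pose Gm := isCumulative.Build R _ R G Gnd (right_continuousW Gc).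
pose GC : cumulative R R := HB.pack G Gm.
pose lam := lebesgue_stieltjes_measure GC.
have lamlt : (lam `]a, b]%classic < +oo)%E.
  apply: le_lt_trans (stieltjes_le_lebesgue (G := GC) _ GK _) _.
    lra.
  rewrite lebesgue_measure_itv/= lte_fin ab -EFinB -EFinM; exact: ltry.
have mab : measurable (`]a, b]%classic : set (measurableTypeR R)).
  exact: measurable_itv.
pose nu : {finite_measure set (measurableTypeR R) -> \bar R} :=
  mfrestr mab lamlt.
have dom : nu `<< (@lebesgue_measure R).
  apply/null_content_dominatesP => A mA A0.
  apply/eqP; rewrite eq_le measure_ge0 andbT.
  apply: (@le_trans _ _ (lam A)).
    by apply: le_measure; rewrite ?inE//; exact: measurableI.
  apply: le_trans (stieltjes_le_lebesgue (G := GC) _ GK _) _.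
    lra.
  by rewrite A0 mule0.
pose h := Radon_Nikodym (charge_of_finite_measure nu) (@lebesgue_measure R).
have hfin x : h x \is a fin_num by exact: Radon_Nikodym_fin_num.
have hE : EFin \o (fine \o h) = h by apply/funext => x; rewrite /= fineK.
have hint : (@lebesgue_measure R).-integrable setT (EFin \o (fine \o h)).
  by rewrite hE; exact: Radon_Nikodym_integrable.
have hloc : locally_integrable setT (fine \o h).
  by apply: open_integrable_locally => //; exact: openT.
have hab y : (@lebesgue_measure R).-integrable
    [set` Interval (BRight a) (BRight y)] (EFin \o (fine \o h)).
  by apply: integrableS hint => //; exact: measurable_itv.
have := FTC1 hab hloc.
apply: filterS => [|t ht].
  exact: (ae_filter_ringOfSetsType (@lebesgue_measure R)).
rewrite in_itv/= => /andP[at_ tb].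
have [+ _] := ht at_.
set H := (fun x : R => _) => dH.
have FE : \near t, H t + (G a - L * t) = F t.
  near=> y.
  have ay : a < y by near: y; exact: lt_nbhsr.
  have yb : y < b by near: y; exact: lt_nbhsl.
  have -> : H y = G y - G a.
    rewrite /H /Rintegral -[RHS]/(fine (G y - G a)%:E).
    have may : measurable (`]a, y]%classic : set (measurableTypeR R)).
      exact: measurable_itv.
    transitivity (fine (nu `]a, y]%classic)); congr fine.
      apply/esym; apply: etrans
        (@Radon_Nikodym_integral _ _ _ (charge_of_finite_measure nu)
          (@lebesgue_measure R) _ dom may) _.
      by apply: eq_integral => u _; rewrite /= fineK ?hfin.
    rewrite /nu /= /mfrestr /mrestr setIidl; last first.
      by move=> u /=; rewrite !in_itv/= => /andP[-> /le_trans ->]//; exact: ltW.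
    transitivity (wlength GC `]a, y]%classic).
      by apply: measurable_mu_extE; exact: is_ocitv.
    by rewrite wlength_itv_bnd// ltW.
  by rewrite /G; ring.
apply: near_eq_derivable FE _.
apply: (derivableD dH); apply: derivableB => //.
Unshelve. all: by end_near. Qed.

(** * The Euclidean structure of row vectors *)

Definition dotv (R : realType) (d : nat) (u v : 'rV[R]_d) : R :=
  \sum_(i < d) u ord0 i * v ord0 i.

Section Euclid.
Context {R : realType} {d : nat}.
Implicit Types (u v w x y z : 'rV[R]_d) (r e : R) (A K S : set 'rV[R]_d).

Lemma dotvC u v : dotv u v = dotv v u.
Proof. by apply: eq_bigr => i _; rewrite mulrC. Qed.

Lemma dotvDl u v w : dotv (u + v) w = dotv u w + dotv v w.
Proof. by rewrite -big_split; apply: eq_bigr => i _; rewrite mxE mulrDl. Qed.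

Lemma dotvDr u v w : dotv w (u + v) = dotv w u + dotv w v.
Proof. by rewrite !(dotvC w) dotvDl. Qed.

Lemma dotvZl r u v : dotv (r *: u) v = r * dotv u v.
Proof. by rewrite mulr_sumr; apply: eq_bigr => i _; rewrite mxE mulrA. Qed.

Lemma dotvZr r u v : dotv u (r *: v) = r * dotv u v.
Proof. by rewrite !(dotvC u) dotvZl. Qed.

Lemma dotvNl u v : dotv (- u) v = - dotv u v.
Proof. by rewrite -scaleN1r dotvZl mulN1r. Qed.

Lemma dotvNr u v : dotv u (- v) = - dotv u v.
Proof. by rewrite !(dotvC u) dotvNl. Qed.

Definition dotvE := (dotvDl, dotvDr, dotvZl, dotvZr, dotvNl, dotvNr).

Lemma dotvv_ge0 u : 0 <= dotv u u.
Proof. by apply: sumr_ge0 => i _; rewrite -expr2 sqr_ge0. Qed.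

Lemma sqr_enorm u : enorm u ^+ 2 = dotv u u.
Proof.
have -> : dotv u u = \sum_(i < d) u ord0 i ^+ 2 by [].
by rewrite sqr_sqrtr// sumr_ge0// => i _; rewrite sqr_ge0.
Qed.

Lemma enorm_ge0 u : 0 <= enorm u.
Proof. exact: sqrtr_ge0. Qed.

Lemma enormN u : enorm (- u) = enorm u.
Proof. by congr Num.sqrt; apply: eq_bigr => i _; rewrite mxE sqrrN. Qed.

Lemma enorm_distC u v : enorm (u - v) = enorm (v - u).
Proof. by rewrite -opprB enormN. Qed.

Lemma enorm_le u r : 0 <= r -> (enorm u <= r) = (dotv u u <= r ^+ 2).
Proof. by move=> r0; rewrite -sqr_enorm ler_pXn2r// nnegrE// enorm_ge0. Qed.

Lemma enorm_lt u r : 0 <= r -> (enorm u < r) = (dotv u u < r ^+ 2).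
Proof. by move=> r0; rewrite -sqr_enorm ltr_pXn2r// nnegrE// enorm_ge0. Qed.

Lemma enormZ r u : enorm (r *: u) = `|r| * enorm u.
Proof.
apply: (@pexpIrn _ 2) => //; rewrite ?nnegrE ?enorm_ge0 ?mulr_ge0//.
  by rewrite enorm_ge0.
by rewrite exprMn !sqr_enorm real_normK ?num_real// !dotvE; ring.
Qed.

Lemma enorm0 : enorm (0 : 'rV[R]_d) = 0.
Proof. by rewrite -(scale0r 0) enormZ normr0 mul0r. Qed.

Lemma norm_le_enorm u : `|u| <= enorm u.
Proof.
rewrite [leLHS]/Num.norm /= mx_normrE.
apply/bigmax_leP; split=> [|[i j] _ /=]; first exact: enorm_ge0.
rewrite (ord1 i) -sqrtr_sqr ler_wsqrtr// (bigD1 j)//= lerDl.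
by rewrite sumr_ge0// => k _; rewrite sqr_ge0.
Qed.

Lemma enorm_le_norm u : enorm u <= d%:R * `|u|.
Proof.
rewrite enorm_le ?mulr_ge0//.
apply: (@le_trans _ _ (\sum_(i < d) `|u| ^+ 2)).
  apply: ler_sum => i _; rewrite -expr2 -real_normK ?num_real//.
  rewrite ler_pXn2r ?nnegrE//.
  rewrite [leRHS]/Num.norm /= mx_normrE.
  by apply/bigmax_geP; right; exists (ord0, i).
rewrite sumr_const card_ord exprMn -[leLHS]mulr_natl.
apply: ler_wpM2r; first exact: sqr_ge0.
by rewrite -natrX ler_nat; case: (d) => // k; rewrite -mulnn leq_pmulr.
Qed.

Lemma enorm_eq0 u : enorm u = 0 -> u = 0.
Proof.
move=> u0; apply/eqP; rewrite -normr_le0 -u0; exact: norm_le_enorm.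
Qed.

Lemma enorm_gt0 u : (0 < enorm u) = (u != 0).
Proof.
rewrite lt_neqAle enorm_ge0 andbT eq_sym; congr negb; apply/eqP/eqP => [|->].
  exact: enorm_eq0.
exact: enorm0.
Qed.

Lemma cauchy_schwarz u v : dotv u v <= enorm u * enorm v.
Proof.
have [u0|u0] := eqVneq (enorm u) 0.
  by rewrite (enorm_eq0 u0) enorm0 mul0r -(scale0r 0) dotvZl mul0r.
have := dotvv_ge0 (enorm v *: u - enorm u *: v).
rewrite !dotvE -!sqr_enorm (dotvC v u).
have {}u0 : 0 < enorm u by rewrite lt_neqAle eq_sym u0 enorm_ge0.
have := enorm_ge0 v; rewrite le_eqVlt => /orP[/eqP v0 _|v0].
  by rewrite (enorm_eq0 (esym v0)) enorm0 mulr0 -(scale0r 0) dotvZr mul0r.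
have uv0 : 0 < enorm u * enorm v by rewrite mulr_gt0.
rewrite (_ : _ + _ = 2 * (enorm u * enorm v) * (enorm u * enorm v - dotv u v)).
  by rewrite pmulr_rge0 ?mulr_gt0// subr_ge0.
ring.
Qed.

Lemma ler_enormD u v : enorm (u + v) <= enorm u + enorm v.
Proof.
rewrite enorm_le ?addr_ge0 ?enorm_ge0// !dotvE -!sqr_enorm (dotvC v u).
have := cauchy_schwarz u v; nra.
Qed.

Lemma ler_enorm_dist w u v : enorm (u - v) <= enorm (u - w) + enorm (w - v).
Proof. by apply: le_trans (ler_enormD _ _); rewrite addrA subrK. Qed.

(** The topology is that of the sup norm, which norm_le_enorm and enorm_le_norm
compare with the Euclidean one. *)
Lemma nbhs_eballP x A :
  nbhs x A <-> exists2 e, 0 < e & eball x e `<=` A.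
Proof.
split=> [/nbhs_ballP[e /= e0 xA]|[e e0 xA]].
  exists e => // y xy; apply: xA; rewrite -ball_normE /= -opprB normrN.
  exact: le_lt_trans (norm_le_enorm _) xy.
have d0 : 0 < d%:R + 1 :> R by rewrite ltr_wpDl.
apply/nbhs_ballP; exists (e / (d%:R + 1)) => /=; first by rewrite divr_gt0.
move=> y; rewrite -ball_normE /= distrC => xy; apply: xA => /=.
apply: le_lt_trans (enorm_le_norm _) _.
move: xy; rewrite ltr_pdivlMr// => xy; apply: le_lt_trans xy.
by rewrite mulrC; apply: ler_wpM2l => //; rewrite lerDl.
Qed.

Lemma eball_center x e : 0 < e -> eball x e x.
Proof. by move=> e0; rewrite /eball /= subrr enorm0. Qed.

(** The one-sided bound suffices because u and v can be exchanged. *)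
Lemma enorm_lipschitz_continuous (g : 'rV[R]_d -> R) (k : R) :
  0 < k -> (forall u v, g u <= g v + k * enorm (u - v)) -> continuous g.
Proof.
move=> k0 gk x; apply/(@cvgrPdist_lt _ _ _ _ (nbhs_filter x)) => e e0.
apply/nbhs_eballP; exists (e / k); first by rewrite divr_gt0.
move=> y; rewrite /eball /= ltr_pdivlMr// => xy.
have := gk x y; have := gk y x; rewrite (enorm_distC x y).
rewrite ltr_distlC => *; apply/andP; split; nra.
Qed.

Lemma enorm_dist_continuous y : continuous (fun x => enorm (x - y)).
Proof.
apply: (@enorm_lipschitz_continuous _ 1) => // u v.
by rewrite mul1r [leRHS]addrC ler_enorm_dist.
Qed.

Lemma closed_le_continuous (g : 'rV[R]_d -> R) r :
  continuous g -> closed [set x | g x <= r].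
Proof.
move=> cg; apply: (closed_comp (f := g) (D := [set t | t <= r])).
  by move=> x _; exact: cg.
exact: closed_le.
Qed.

Lemma compact_enorm_bounded A x : compact A ->
  exists M, forall y, A y -> enorm (y - x) <= M.
Proof.
move=> cA; have [->|/set0P A0] := eqVneq A set0; first by exists 0.
have cf : {within A, continuous (fun y => enorm (y - x))}.
  exact/continuous_subspaceT/enorm_dist_continuous.
have [y _ yM] := compact_EVT_max A0 cA cf.
by exists (enorm (y - x)) => z Az; apply: yM; rewrite inE.
Qed.

Lemma compact_closed_eball x r A :
  closed A -> (forall y, A y -> enorm (y - x) <= r) -> compact A.
Proof.
move=> clA Ar; apply: bounded_closed_compact => //.
exists (`|x| + r); split; first exact: num_real.
move=> M xM y Ay; apply: le_trans (ltW xM).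
rewrite -[X in `|X|](subrK x) addrC; apply: le_trans (ler_normD _ _) _.
by rewrite lerD2l; apply: le_trans (norm_le_enorm _) (Ar _ Ay).
Qed.

(** Passing to the limit in a construction that succeeds up to any error: the
infimum of g is nonpositive, and compactness makes it a minimum. *)
Lemma compact_attain (g : 'rV[R]_d -> R) A : compact A -> continuous g ->
  (forall e, 0 < e -> exists2 a, A a & g a <= e) -> exists2 a, A a & g a <= 0.
Proof.
move=> cA cg gA.
have A0 : A !=set0 by have [a Aa _] := gA 1 ltr01; exists a.
have [a Aa ag] := compact_EVT_min A0 cA (continuous_subspaceT cg).
exists a; first by rewrite inE in Aa.
apply/ler_addgt0Pr => e e0; rewrite add0r; have [b Ab] := gA _ e0.
by apply: le_trans; apply: ag; rewrite inE.
Qed.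

End Euclid.

(** * Sets with prox-regular complement contain touching balls *)

Section InnerBall.
Context {R : realType} {d : nat}.
Implicit Types (u v w x y z : 'rV[R]_d) (r e : R) (A K S : set 'rV[R]_d).

(** The real value of dist_set; it is meaningful for nonempty S only, since
dist_set v set0 is infinite. *)
Definition rdist S v : R := fine (dist_set v S).

Lemma dist_setE S s v : S s -> dist_set v S = (rdist S v)%:E.
Proof.
move=> Ss; rewrite fineK// ge0_fin_numE.
  apply: le_lt_trans (ltry (enorm (v - s))).
  by apply: ereal_inf_lbound; exists s.
by apply: le_ereal_inf_tmp => _ [t _ <-]; rewrite lee_fin enorm_ge0.
Qed.

Lemma rdist_le S s v : S s -> rdist S v <= enorm (v - s).
Proof.
move=> Ss; rewrite -lee_fin -(dist_setE _ Ss).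
by apply: ereal_inf_lbound; exists s.
Qed.

Lemma rdist_ge S s v r : S s -> (forall t, S t -> r <= enorm (v - t)) ->
  r <= rdist S v.
Proof.
move=> Ss rS; rewrite -lee_fin -(dist_setE _ Ss).
by apply: le_ereal_inf_tmp => _ [t St <-]; rewrite lee_fin rS.
Qed.

Lemma rdist_lt S s v r : S s -> rdist S v < r ->
  exists2 t, S t & enorm (v - t) < r.
Proof.
move=> Ss; apply: contraPP => /forall2NP nS; apply/negP; rewrite -leNgt.
apply: (rdist_ge Ss) => t St; rewrite leNgt; apply/negP => vt.
by case: (nS t).
Qed.

Lemma rdist_lipschitz S s u v : S s -> rdist S u <= rdist S v + enorm (u - v).
Proof.
move=> Ss; rewrite -lerBlDr; apply: (rdist_ge Ss) => t St.
rewrite lerBlDr; apply: le_trans (rdist_le _ St) _.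
by rewrite [leRHS]addrC; exact: ler_enorm_dist.
Qed.

(** Moving from v straight away from its unique nearest point p increases the
distance to S at unit speed. Otherwise, with m the unit vector from p to v, the
points v + t m have nearly nearest points q in S with <m, v - q> <= (1 - e/2) s,
where s is the distance of v. As t tends to 0 these q accumulate at a nearest
point of v, which differs from p because <m, v - p> = s. *)
Lemma prox_regular_ascent S r v e :
  prox_regular r S -> S !=set0 -> 0 < rdist S v -> rdist S v < r ->
  0 < e -> e <= 1 ->
  exists w, (1 - e) * enorm (w - v) < rdist S w - rdist S v.
Proof.
move=> [clS uS] [s0 Ss0] s_gt0 sr e0 e1; set s := rdist S v in s_gt0 sr *.
have [p [[Sp vp] p_uniq]] : exists! p, S p /\ (enorm (v - p))%:E = dist_set v S.
  by apply: uS; rewrite (dist_setE _ Ss0) lte_fin.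
have {}vp : enorm (v - p) = s.
  by move: vp; rewrite (dist_setE _ Ss0) => -[].
apply: contrapT => /forallNP noasc.
have {}noasc w : rdist S w <= s + (1 - e) * enorm (w - v).
  by rewrite -lerBlDl leNgt; apply/negP/noasc.
pose m := s^-1 *: (v - p).
have mp : dotv m (v - p) = s.
  by rewrite dotvZl -sqr_enorm vp expr2 mulrA mulVf ?mul1r// gt_eqF.
have m1 : enorm m = 1.
  by rewrite enormZ vp gtr0_norm ?invr_gt0// mulVf// gt_eqF.
have mm : dotv m m = 1 by rewrite -sqr_enorm m1 expr1n.
clearbody m.
pose A := S `&` [set q | enorm (q - v) <= s + 2]
            `&` [set q | dotv m (v - q) <= (1 - e / 2) * s].
have clA : closed A.
  apply: closedI; first apply: closedI => //.
    exact/closed_le_continuous/enorm_dist_continuous.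
  apply/closed_le_continuous/(@enorm_lipschitz_continuous _ _ _ 1) => // q1 q2.
  have := cauchy_schwarz m (q2 - q1); rewrite (enorm_distC q1 q2).
  rewrite m1.
  rewrite !dotvE; lra.
have cA : compact A.
  by apply: (@compact_closed_eball _ _ v (s + 2)) => // q [[]].
have [||q [[Sq _] mq] vq] :=
  compact_attain (g := fun q => enorm (q - v) - s) cA.
- apply: (@enorm_lipschitz_continuous _ _ _ 1) => // q1 q2.
  by have := ler_enorm_dist q2 q1 v; lra.
- move=> e' e'0.
  pose t := Num.min (e' / 2) 1.
  have t0 : 0 < t by rewrite lt_min divr_gt0//= ltr01.
  have t1 : t <= 1 by rewrite ge_min lexx orbT.
  have te : t <= e' / 2 by rewrite ge_min lexx.
  have [q Sq wq] : exists2 q, S q &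
      enorm (v + t *: m - q) < s + (1 - e / 2) * t.
    apply: (rdist_lt Ss0); apply: le_lt_trans (noasc _) _.
    rewrite addrAC subrr add0r enormZ m1 mulr1 gtr0_norm//; nra.
  have sq : s <= enorm (v - q) by exact: rdist_le.
  have vq : enorm (q - v) <= s + 2 * t.
    rewrite enorm_distC.
    have := ler_enorm_dist (v + t *: m) v q.
    rewrite opprD addrA subrr add0r enormN enormZ m1 mulr1 gtr0_norm//.
    have : 0 < e * t by rewrite mulr_gt0.
    lra.
  exists q; last by rewrite lerBlDl; lra.
  split; first by split=> //=; lra.
  rewrite /=.
  have : (s + (1 - e / 2) * t) >= 0.
    by apply: le_trans (ltW wq); exact: enorm_ge0.
  move=> st0; move: wq.
  have -> : v + t *: m - q = (v - q) + t *: m by rewrite addrAC.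
  rewrite enorm_lt//.
  have {}sq : s ^+ 2 <= dotv (v - q) (v - q).
    by rewrite -sqr_enorm ler_pXn2r// nnegrE ?enorm_ge0 ?ltW.
  move: sq; generalize (v - q) => a; rewrite !dotvE mm (dotvC a m) => sq wq.
  have : 2 * t * dotv m a <= 2 * t * ((1 - e / 2) * s).
    have : (1 - e / 2) ^+ 2 * t ^+ 2 <= t ^+ 2.
      by rewrite ler_piMl ?sqr_ge0//; nra.
    nra.
  by rewrite ler_pM2l// mulr_gt0.
have {vq} vq : enorm (v - q) = s.
  apply/eqP; rewrite eq_le rdist_le// enorm_distC andbT; lra.
have pq : p = q by apply: p_uniq; rewrite vq (dist_setE _ Ss0).
move: mq; rewrite /= -pq mp; nra.
Qed.

(** Start from an interior point u close to x and maximize over K the function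
rdist - (1 - eps) |. - u|, where rdist is the distance to the complement S of
the interior. At a maximizer v the distance to S increases at rate at most
1 - eps in every direction, so by prox_regular_ascent it is at least r; it is
also at least (1 - eps) |v - u|, which is nearly |v - x|. In the limit the ball
around v whose radius is the distance of v to S touches x. *)
Lemma prox_regular_touching_ball K r x :
  compact K -> prox_regular r (~` K°) -> closure K° x -> ~ K° x ->
  exists2 v, r <= enorm (x - v) & eball v (enorm (x - v)) `<=` K°.
Proof.
move=> cK pK clx nx; pose S := ~` K°.
have Sx : S x by [].
have [M0 M0K] := compact_enorm_bounded x cK.
pose M := Num.max M0 0.
have M_ge0 : 0 <= M by rewrite le_max lexx orbT.
have MK y : K y -> enorm (y - x) <= M by move=> /M0K yM; rewrite le_max yM.
pose g v := Num.max (r - rdist S v) (enorm (x - v) - rdist S v).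
have gc : continuous g.
  apply: (@enorm_lipschitz_continuous _ _ _ 2) => // u v.
  have := rdist_lipschitz v u Sx; rewrite (enorm_distC v u) => uv.
  have := ler_enorm_dist v x u; rewrite (enorm_distC v u) => xuv.
  have /andP[h1 h2] :
      (r - rdist S v <= g v) && (enorm (x - v) - rdist S v <= g v).
    by rewrite !le_max !lexx orbT.
  have := enorm_ge0 (u - v).
  by rewrite ge_max => uv0; apply/andP; split; lra.
have [e e0|v Kv gv] := compact_attain cK gc; last first.
  exists v.
    have -> : enorm (x - v) = rdist S v.
      apply/eqP; rewrite eq_le enorm_distC rdist_le// andbT enorm_distC.
      by rewrite -subr_le0; apply: le_trans gv; rewrite le_max lexx orbT.
    by rewrite -subr_le0; apply: le_trans gv; rewrite le_max lexx.
  move=> y; rewrite /eball /= => vy; apply: contrapT => Sy.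
  have := rdist_le v (Sy : S y); rewrite enorm_distC leNgt => /negP; apply.
  apply: lt_le_trans vy _.
  by rewrite -subr_le0; apply: le_trans gv; rewrite le_max lexx orbT.
have [u [Ku xu]] : exists u, K° u /\ eball x (Num.min (e / 2) 1) u.
  apply: clx; apply/nbhs_eballP; exists (Num.min (e / 2) 1) => //.
  by rewrite lt_min ltr01 andbT divr_gt0.
have [xu2 xu1] : enorm (u - x) < e / 2 /\ enorm (u - x) < 1.
  by move: xu; rewrite /eball /= lt_min => /andP[].
have u_gt0 : 0 < rdist S u.
  have /nbhs_eballP[rho rho0 rhoK] : nbhs u K°.
    exact: (open_nbhs_nbhs (conj (open_interior _) Ku)).
  apply: lt_le_trans rho0 _; apply: (rdist_ge Sx) => t St.
  rewrite leNgt enorm_distC; apply/negP => ut; exact/St/rhoK.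
pose eps := Num.min 1 (e / 2 / (M + 1)).
have eps0 : 0 < eps by rewrite lt_min ltr01/= !divr_gt0// ltr_wpDl.
have eps1 : eps <= 1 by rewrite ge_min lexx.
have epsM : eps * (M + 1) <= e / 2.
  by rewrite -ler_pdivlMr ?ltr_wpDl// ge_min lexx orbT.
pose phi v := rdist S v - (1 - eps) * enorm (v - u).
have phic : continuous phi.
  apply: (@enorm_lipschitz_continuous _ _ _ 2) => // v w; rewrite /phi.
  have := rdist_lipschitz v w Sx => vw.
  have := ler_enorm_dist v w u; rewrite (enorm_distC w v) => wvu.
  have := enorm_ge0 (v - w); nra.
have K0 : K !=set0 by exists u; exact: interior_subset.
have [v] := compact_EVT_max K0 cK (continuous_subspaceT phic).
rewrite inE => Kv vmax.
have phiv : rdist S u <= phi v.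
  have := vmax u; rewrite inE /phi subrr enorm0 mulr0 subr0; apply.
  exact: interior_subset.
have phi_max w : phi w <= phi v.
  have [Kw|nKw] := pselect (K w); first by apply: vmax; rewrite inE.
  apply: le_trans phiv; apply: (@le_trans _ _ 0); last exact: ltW.
  have Sw : S w by move=> /interior_subset.
  have := rdist_le w Sw; rewrite subrr enorm0 /phi.
  have := enorm_ge0 (w - u); nra.
have v_gt0 : 0 < rdist S v.
  by move: phiv; rewrite /phi; have := enorm_ge0 (v - u); nra.
exists v => //; rewrite ge_max; apply/andP; split.
  apply: (@le_trans _ _ 0); last exact: ltW.
  rewrite subr_le0 leNgt; apply/negP => vr.
  have [w] := prox_regular_ascent pK (ex_intro _ x Sx) v_gt0 vr eps0 eps1.
  have := phi_max w; rewrite /phi.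
  have := ler_enorm_dist v w u; nra.
have := ler_enorm_dist u x v; rewrite (enorm_distC x u) (enorm_distC u v).
move: phiv; rewrite /phi.
have : enorm (v - u) <= M + 1.
  have := ler_enorm_dist x v u; rewrite (enorm_distC x u).
  by have := MK _ Kv; lra.
have := enorm_ge0 (v - u); nra.
Qed.

End InnerBall.

(** * Supporting half-spaces at touching balls *)

Section Convex.
Context {R : realType} {d : nat}.
Implicit Types (x y z v b : 'rV[R]_d) (K : set 'rV[R]_d).

Definition convexv K := forall x y (t : R),
  0 <= t <= 1 -> K x -> K y -> K (t *: x + (1 - t) *: y).

Lemma convexv_interior K x b (t : R) :
  convexv K -> K x -> K° b -> 0 < t -> t <= 1 -> K° (x + t *: (b - x)).
Proof.
move=> cK Kx /nbhs_eballP[rho rho0 Kb] t0 t1.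
apply/nbhs_eballP; exists (t * rho); first by rewrite mulr_gt0.
move=> y; rewrite /eball /= => yt.
pose b' := b + t^-1 *: (y - (x + t *: (b - x))).
have tn0 : t != 0 by rewrite gt_eqF.
have -> : y = t *: b' + (1 - t) *: x.
  rewrite /b' scalerDr scalerA divff// scale1r.
  by apply/rowP => i; rewrite !mxE; ring.
apply: cK => //; first by rewrite ltW.
apply: Kb; rewrite /eball /= /b' addrAC subrr add0r enormZ.
by rewrite gtr0_norm ?invr_gt0// mulrC ltr_pdivrMr// mulrC.
Qed.

Lemma convexv_closure_interior K x b :
  convexv K -> K x -> K° b -> closure K° x.
Proof.
move=> cK Kx Kb A /nbhs_eballP[e e0 eA].
have h0 : 0 < enorm (b - x) + 1 by rewrite ltr_wpDl// enorm_ge0.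
pose t := Num.min 1 (e / (enorm (b - x) + 1)).
have t0 : 0 < t by rewrite lt_min ltr01 divr_gt0.
have t1 : t <= 1 by rewrite ge_min lexx.
have te : t * (enorm (b - x) + 1) <= e.
  by rewrite -ler_pdivlMr// ge_min lexx orbT.
exists (x + t *: (b - x)); split; first exact: convexv_interior.
apply: eA; rewrite /eball /= addrAC subrr add0r enormZ gtr0_norm//.
by move: te; rewrite mulrDr mulr1; lra.
Qed.

(** A ball inside K that touches the boundary at x determines a supporting
half-space: a point z of K beyond it would put x in the interior of the hull of
z and the ball. *)
Lemma touching_ball_support K x v z :
  convexv K -> ~ K° x -> eball v (enorm (x - v)) `<=` K° -> K z ->
  dotv (z - x) (x - v) <= 0.
Proof.
move=> cK nx vK Kz; rewrite leNgt; apply/negP; set s := dotv _ _ => s0.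
have h0 : 0 < dotv (z - x) (z - x) + 1 by rewrite ltr_wpDl// dotvv_ge0.
pose t := s / (dotv (z - x) (z - x) + 1).
have t0 : 0 < t by rewrite divr_gt0.
have ts : t * (dotv (z - x) (z - x) + 1) = s by rewrite divfK// gt_eqF.
pose w := x - t *: (z - x).
have Kw : K° w.
  apply: vK; rewrite /eball /= enorm_lt ?enorm_ge0// sqr_enorm.
  have -> : w - v = (x - v) - t *: (z - x) by rewrite /w addrAC.
  move: ts; rewrite /s; generalize (z - x) (x - v) => a c ts.
  rewrite !dotvE (dotvC c a); have := dotvv_ge0 a; nra.
apply: nx; have t1 : 0 < 1 + t by lra.
have -> : x = z + (1 + t)^-1 *: (w - z).
  have -> : w - z = - ((1 + t) *: (z - x)).
    by rewrite /w; apply/rowP => i; rewrite !mxE; ring.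
  by rewrite scalerN scalerA mulVf ?gt_eqF// scale1r opprB addrC subrK.
by apply: convexv_interior; rewrite ?invr_gt0// invf_le1//; lra.
Qed.

End Convex.

(** * The slope *)

Section Slope.
Context {R : realType} {d : nat}.
Implicit Types (x y b : 'rV[R]_d) (f : 'rV[R]_d -> \bar R).

Lemma slope_gt_exists f x (l e : R) : 0 <= l -> 0 < e -> (f x < +oo)%E ->
  f x <> -oo%E -> (l%:E < slope f x)%E ->
  exists y, [/\ eball x e y, y != x & (f y + (l * enorm (x - y))%:E < f x)%E].
Proof.
move=> l0 e0 fx fxNy; rewrite /slope fx => ls.
have fxfin : f x \is a fin_num.
  by rewrite fin_numE; apply/andP; split; [exact/eqP|rewrite lt_eqF].
pose q := fun y => (maxe (f x - f y) 0 * ((enorm (x - y))^-1)%R%:E)%E.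
have : (l%:E < ereal_sup (q @` (eball x e `\ x)))%E.
  apply: lt_le_trans ls _; apply: ereal_inf_lbound.
  exists (eball x e `\ x) => //.
  by apply/nbhs_eballP; exists e => // y xy /eqP yx; split.
move=> /ereal_sup_gt[_ [y [xy yx] <-]] lq.
exists y; split => //; first exact/eqP.
have n0 : 0 < enorm (x - y).
  by rewrite enorm_gt0 subr_eq0 eq_sym; exact/eqP.
move: lq; rewrite /q lte_pdivlMr// -EFinM.
case: (f x) fxfin => // a _; case: (f y) => [c||]; last by rewrite ltNyr.
  rewrite -EFinB -EFin_max lte_fin -EFinD lte_fin lt_max.
  move=> /orP[|]; first by lra.
  have : 0 <= l * enorm (x - y) by rewrite mulr_ge0// ltW.
  lra.
rewrite /= max_r ?leNye// => h.
have {}h : l * enorm (x - y) < 0 by rewrite -lte_fin; exact: h.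
by move: h; rewrite ltNge mulr_ge0// ltW.
Qed.

Lemma slope_ge f x (l : R) : f x \is a fin_num ->
  (forall e, 0 < e -> exists y,
    [/\ eball x e y, y != x & (f y + (l * enorm (x - y))%:E <= f x)%E]) ->
  (l%:E <= slope f x)%E.
Proof.
move=> fxfin lx; have fx : (f x < +oo)%E by rewrite ltey_eq fxfin.
rewrite /slope fx; apply: le_ereal_inf_tmp => _ [V /nbhs_eballP[e e0 eV] <-].
have [y [xy yx fy]] := lx e e0.
apply: le_ereal_sup_tmp.
exists (maxe (f x - f y) 0 * ((enorm (x - y))^-1)%R%:E)%E.
  by exists y => //; apply: eV.
have n0 : 0 < enorm (x - y) by rewrite enorm_gt0 subr_eq0 eq_sym.
rewrite lee_pdivlMr// -EFinM le_max; apply/orP; left.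
move: fxfin fy; case: (f x) => // r _; case: (f y) => [c||] /=; last first.
- by rewrite leey.
- by rewrite leye_eq.
by rewrite -EFinB -EFinD !lee_fin; lra.
Qed.

Lemma slope_argmin f x : (0 < d)%N -> (forall y, f y <> -oo%E) ->
  (f x < +oo)%E -> argmin f x -> slope f x = 0%E.
Proof.
move=> d0 fNy fx fmin; rewrite /slope fx.
have fxfin : f x \is a fin_num.
  by rewrite fin_numE; apply/andP; split; [exact/eqP|rewrite lt_eqF].
pose q := fun y => (maxe (f x - f y) 0 * ((enorm (x - y))^-1)%R%:E)%E.
have q0 y : q y = 0%E.
  by rewrite /q max_r ?mul0e// sube_le0.
have dn (V : set 'rV[R]_d) : x^' V -> exists y, V y.
  move=> /nbhs_eballP[e e0 eV].
  pose u := \row_(i < d) (1 : R).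
  have u0 : u != 0.
    apply/eqP => /rowP /(_ (Ordinal d0)); rewrite !mxE; apply/eqP.
    exact: oner_neq0.
  have un : 0 < enorm u by rewrite enorm_gt0.
  exists (x + (e / 2 / enorm u) *: u); apply: eV.
    rewrite /eball /= addrAC subrr add0r enormZ gtr0_norm ?divr_gt0//.
    by rewrite divfK ?gt_eqF//; lra.
  rewrite -subr_eq0 addrAC subrr add0r scaler_eq0 negb_or u0 gt_eqF//.
  by rewrite !divr_gt0.
apply/eqP; rewrite eq_le; apply/andP; split.
  apply: ereal_inf_le; exists (ereal_sup (q @` setT)).
    by exists setT => //; exact: filterT.
  by apply: ge_ereal_sup => _ [y _ <-]; rewrite q0.
apply: le_ereal_inf_tmp => _ [V /dn[y Vy] <-].
by apply: le_ereal_sup_tmp; exists (q y); [exists y|rewrite q0].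
Qed.

(** If x were interior to [f <= f x], the convex set [f < f x] would be dense near
x, because no point near x is a local minimum; having an interior point b, it
would then contain x itself. *)
Lemma not_interior_sublevel f x b (a c delta : R) :
  quasiconvex f -> (forall y, f y <> -oo%E) -> f x = a%:E -> c < a ->
  (sublevel f c)° b -> 0 < delta ->
  (forall y, eball x delta y -> (f y < +oo)%E -> (0 < slope f y)%E) ->
  ~ (sublevel f a)° x.
Proof.
move=> qf fNy fxa ca /nbhs_eballP[rho rho0 Kb] delta0 sf /nbhs_eballP[e e0 Ka].
have h0 : 0 < enorm (x - b) + 1 by rewrite ltr_wpDl// enorm_ge0.
pose t := Num.min delta e / 2 / (enorm (x - b) + 1).
have m0 : 0 < Num.min delta e by rewrite lt_min delta0.
have t0 : 0 < t by rewrite !divr_gt0.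
pose y := x + t *: (x - b).
have yx : enorm (y - x) < Num.min delta e.
  rewrite /y addrAC subrr add0r enormZ gtr0_norm//.
  have : t * (enorm (x - b) + 1) = Num.min delta e / 2.
    by rewrite divfK// gt_eqF.
  by rewrite mulrDr mulr1; lra.
have fy : (f y <= a%:E)%E.
  by apply: Ka; apply: lt_le_trans yx _; rewrite ge_min lexx orbT.
have fy_lt : (f y < +oo)%E by apply: le_lt_trans fy (ltry _).
have fys : (0%:E < slope f y)%E.
  by apply: sf => //; apply: lt_le_trans yx _; rewrite ge_min lexx.
have tr0 : 0 < t * rho by rewrite mulr_gt0.
have [y' [yy' _]] := slope_gt_exists (lexx 0) tr0 fy_lt (fNy y) fys.
rewrite mul0r adde0 => fy'.
(* b' is chosen so that x divides the segment from y' to b' in the ratio t : 1 *)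
pose b' := b + t^-1 *: (y - y').
have fb' : (f b' <= c%:E)%E.
  apply: Kb; rewrite /eball /= /b' addrAC subrr add0r enormZ enorm_distC.
  by rewrite gtr0_norm ?invr_gt0// mulrC ltr_pdivrMr// mulrC.
have t1 : 0 < 1 + t by lra.
have := qf y' b' (1 + t)^-1.
have -> : (1 + t)^-1 *: y' + (1 - (1 + t)^-1) *: b' = x.
  have -> : 1 - (1 + t)^-1 = (1 + t)^-1 * t.
    by field; rewrite gt_eqF.
  have tb' : t *: b' = t *: b + (y - y').
    by rewrite /b' scalerDr scalerA divff ?gt_eqF// scale1r.
  rewrite -scalerA -scalerDr tb'.
  have -> : y' + (t *: b + (y - y')) = (1 + t) *: x.
    by rewrite /y; apply/rowP => i; rewrite !mxE; ring.
  by rewrite scalerA mulVf ?gt_eqF// scale1r.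
rewrite invr_ge0 ltW//= invf_le1// lerDl ltW// => /(_ isT).
rewrite leNgt => /negP; apply; rewrite gt_max fxa.
by rewrite (lt_le_trans fy' fy) (le_lt_trans fb')// lte_fin.
Qed.

End Slope.

(** * Inner normals of sublevel sets *)

Section BallNormal.
Context {R : realType} {d : nat}.
Implicit Types (x y z m n : 'rV[R]_d) (r : R) (f : 'rV[R]_d -> \bar R).

(** The vector n is an outward unit normal at x to the sublevel set of x, in a
two-sided form: a half-space bounds that set from outside, and a ball of radius r
tangent to the half-space at x bounds it from inside. *)
Definition ball_normal f r x n :=
  [/\ enorm n = 1,
      forall z, (f z <= f x)%E -> dotv (z - x) n <= 0 &
      forall z, eball (x - r *: n) r z -> (f z <= f x)%E].

Lemma sublevel_ball_normal f r x (a : R) :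
  quasiconvex f -> f x = a%:E -> 0 < r -> compact (sublevel f a) ->
  prox_regular r (~` (sublevel f a)°) -> (sublevel f a)° !=set0 ->
  ~ (sublevel f a)° x -> exists n, ball_normal f r x n.
Proof.
move=> qf fxa r0 cK pK [b Kb] nx.
have convK : convexv (sublevel f a).
  move=> u v t t01 fu fv; apply: le_trans (qf _ _ _ t01) _.
  by rewrite ge_max fu fv.
have Kx : sublevel f a x by rewrite /sublevel /= fxa.
have [v rv vK] := prox_regular_touching_ball cK pK
  (convexv_closure_interior convK Kx Kb) nx.
have v0 : 0 < enorm (x - v) by exact: lt_le_trans rv.
pose n := (enorm (x - v))^-1 *: (x - v).
have n1 : enorm n = 1.
  by rewrite enormZ gtr0_norm ?invr_gt0// mulVf// gt_eqF.
have xv : x - v = enorm (x - v) *: n by rewrite scalerA divff ?gt_eqF// scale1r.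
exists n; split => // z.
  rewrite fxa => fz; rewrite dotvZr pmulr_rle0 ?invr_gt0//.
  exact: touching_ball_support convK nx vK fz.
rewrite /eball /= => zr; rewrite fxa.
apply: (@interior_subset _ (sublevel f a)).
apply: vK; rewrite /eball /=.
apply: le_lt_trans (ler_enorm_dist (x - r *: n) _ _) _.
have -> : x - r *: n - v = (enorm (x - v) - r) *: n.
  by rewrite addrAC {1}xv scalerBl.
by rewrite enormZ n1 mulr1 ger0_norm ?subr_ge0//; lra.
Qed.

(** The ball at y lies in the sublevel set of y, hence in that of x, hence in the
half-space at x; the bound says so for the point y - r m + r n farthest in the
direction n. *)
Lemma ball_normal_angle f r x y n m : 0 < r ->
  ball_normal f r x n -> ball_normal f r y m -> (f y <= f x)%E ->
  r * (1 - dotv m n) <= dotv (x - y) n.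
Proof.
move=> r0 [n1 xn _] [_ _ ym] yx; apply/ler_addgt0Pr => e e0.
pose e' := Num.min e r.
have e'0 : 0 < e' by rewrite lt_min e0.
have : dotv (y - r *: m + (r - e') *: n - x) n <= 0.
  apply: xn; apply: le_trans yx; apply: ym.
  rewrite /eball /= addrAC subrr add0r enormZ n1 mulr1 ger0_norm.
    by rewrite ltrBlDr ltrDl.
  by rewrite subr_ge0 ge_min lexx orbT.
have -> : y - r *: m + (r - e') *: n - x = - (x - y) - r *: m + (r - e') *: n.
  by apply/rowP => i; rewrite !mxE; ring.
have nn : dotv n n = 1 by rewrite -sqr_enorm n1 expr1n.
generalize (x - y) => v; rewrite !dotvE nn.
have : e' <= e by rewrite ge_min lexx.
lra.
Qed.

(** For unit vectors |n - m|^2 = 2 (1 - <n, m>), and ball_normal_angle applies to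
the two points in the order of their values. *)
Lemma ball_normal_holder f r x y n m : 0 < r ->
  ball_normal f r x n -> ball_normal f r y m ->
  r * enorm (n - m) ^+ 2 <= 2 * enorm (x - y).
Proof.
move=> r0; wlog yx : x y n m / (f y <= f x)%E => [hw xn ym|xn ym].
  have [yx|/ltW xy] := leP (f y) (f x); first exact: hw.
  by rewrite enorm_distC (enorm_distC x); exact: hw.
have := ball_normal_angle r0 xn ym yx.
have [n1 _ _] := xn; have [m1 _ _] := ym.
have := cauchy_schwarz (x - y) n; rewrite n1 mulr1.
rewrite sqr_enorm; generalize (x - y) => v.
by rewrite !dotvE -!sqr_enorm n1 m1 expr1n (dotvC n m); lra.
Qed.

End BallNormal.

(** The hypotheses at x0 hold with the same constants near x0. The slope stays
above l by (b). The values stay so close to f x0 that (c) at the level f x0 gives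
one radius r, and they stay above a level c whose sublevel set has an interior
point b, which is then interior to all nearby sublevel sets. Coercivity and (c)
need values below the supremum of f: since x is never interior to its own
sublevel set, f x is not the supremum. *)
Lemma regular_neighborhood (R : realType) (d : nat)
    (f : 'rV[R]_d -> \bar R) (O : set 'rV[R]_d) (x0 : 'rV[R]_d)
    (f_ninfty : forall x, f x <> -oo%E)
    (f_qcvx : quasiconvex f)
    (O_open : open O)
    (O_dom : O `<=` dom f)
    (f_lip : locally_lipschitz_on f O)
    (f_coer : coercive f)
    (f_int : forall a : R, (inf_fun f < a%:E)%E -> (sublevel f a)° !=set0)
    (hb : forall x, (dom f `\` argmin f) x ->
        exists delta l : R, [/\ 0 < delta, 0 < l &
          forall y, (eball x delta `&` dom f) y -> (l%:E < slope f y)%E])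
    (hc : forall a : R, (inf_fun f < a%:E)%E -> (a%:E < sup_fun f)%E ->
        exists eta r : R, [/\ 0 < eta, 0 < r &
          forall b : R, a - eta < b -> b < a + eta ->
            prox_regular r (~` (sublevel f b)°)]) :
  O x0 -> ~ argmin f x0 ->
  exists delta r l L : R, [/\ 0 < delta, 0 < r, 0 < l &
    forall x, eball x0 delta x ->
    [/\ f x \is a fin_num, (l%:E < slope f x)%E,
        exists n, ball_normal f r x n &
        forall y, eball x0 delta y ->
          `|fine (f x) - fine (f y)| <= L * enorm (x - y)]].
Proof.
move=> Ox0 x0min.
have fin x : dom f x -> f x \is a fin_num.
  move=> fx; rewrite fin_numE; apply/andP; split; first exact/eqP.
  by rewrite lt_eqF.
have [delta1 [l [delta10 l0 sl]]] := hb x0 (conj (O_dom _ Ox0) x0min).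
have [delta2 delta20 O2] : exists2 e, 0 < e & eball x0 e `<=` O.
  by apply/nbhs_eballP; exact: open_nbhs_nbhs.
have [delta3 [L0 [delta30 fL0]]] := f_lip x0 Ox0.
pose L := Num.max L0 1.
have L1 : 0 < L by rewrite lt_max ltr01 orbT.
have fL y z : O y -> O z -> eball x0 delta3 y -> eball x0 delta3 z ->
    `|fine (f y) - fine (f z)| <= L * enorm (y - z).
  move=> Oy Oz y3 z3; apply: le_trans (fL0 y z Oy Oz y3 z3) _.
  by rewrite ler_wpM2r ?enorm_ge0// le_max lexx.
have [z fzx0] : exists z, (f z < f x0)%E.
  apply: contrapT => /forallNP nz; apply: x0min => y.
  by rewrite leNgt; apply/negP/nz.
have fx0 := fin x0 (O_dom _ Ox0).
have fz : f z \is a fin_num by apply: fin; apply: lt_trans fzx0 _; exact: O_dom.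
pose a0 := fine (f x0); pose c := (fine (f z) + a0) / 2.
have za0 : fine (f z) < a0 by rewrite /a0 -lte_fin !fineK.
have inf_lt (a : R) : c <= a -> (inf_fun f < a%:E)%E.
  move=> ca; apply: (@le_lt_trans _ _ (f z)).
    by apply: ereal_inf_lbound; exists z.
  by rewrite -(fineK fz) lte_fin; rewrite /c in ca; lra.
have [b Kb] := f_int c (inf_lt c (lexx _)).
pose delta := Num.min (Num.min delta1 delta2) delta3.
have inK (e : R) x : e <= delta -> eball x0 e x ->
    [/\ eball x0 delta1 x, O x & eball x0 delta3 x].
  rewrite /delta !le_min => /andP[/andP[e1 e2] e3] xe.
  split; [|apply: O2|]; exact: lt_le_trans xe _.
have not_int (x : 'rV[R]_d) : eball x0 delta x -> c < fine (f x) ->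
    ~ (sublevel f (fine (f x)))° x.
  move=> xd cx; have [x1 Ox x3] := inK delta x (lexx _) xd.
  apply: (@not_interior_sublevel _ _ f x b _ c (delta1 - enorm (x - x0))) => //.
  - by rewrite fineK// fin//; exact: O_dom.
  - by rewrite subr_gt0.
  move=> y xy fy; apply: lt_trans (sl y _); first by rewrite lte_fin.
  split => //; rewrite /eball /=.
  have := ler_enorm_dist x y x0; move: xy; rewrite /eball /=; lra.
have lt_sup x : eball x0 delta x -> c < fine (f x) ->
    ((fine (f x))%:E < sup_fun f)%E.
  move=> xd cx; rewrite ltNge; apply/negP => sup_le; apply: (not_int x xd cx).
  apply/nbhs_eballP; exists 1 => // y _.
  by apply: le_trans sup_le; apply: ereal_sup_ubound; exists y.
have delta0 : 0 < delta by rewrite !lt_min delta10 delta20.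
have x0d : eball x0 delta x0 by exact: eball_center.
have ca0 : c < a0 by rewrite /c; lra.
have [eta [r [eta0 r0 pr]]] := hc a0 (inf_lt _ (ltW ca0)) (lt_sup _ x0d ca0).
pose deltaf := Num.min delta (Num.min eta (a0 - c) / L).
have dfL : deltaf * L <= Num.min eta (a0 - c).
  by rewrite -ler_pdivlMr// ge_min lexx orbT.
have df0 : 0 < deltaf.
  by rewrite lt_min delta0 divr_gt0// lt_min eta0 subr_gt0.
have dfd : deltaf <= delta by rewrite ge_min lexx.
exists deltaf, r, l, L; split => // x xdf.
have xd : eball x0 delta x by exact: lt_le_trans xdf dfd.
have [x1 Ox x3] := inK _ x dfd xdf.
have fx := fin x (O_dom _ Ox).
have : `|fine (f x) - a0| < Num.min eta (a0 - c).
  apply: lt_le_trans dfL; apply: le_lt_trans (fL _ _ Ox Ox0 x3 _) _.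
    exact: eball_center.
  by rewrite mulrC ltr_pM2r.
rewrite lt_min !ltr_distl => /andP[/andP[a1 a2] /andP[a3 _]].
have cx : c < fine (f x) by lra.
split => //.
- by apply: sl; split => //; exact: O_dom.
- apply: (sublevel_ball_normal (a := fine (f x))) => //.
  + by rewrite fineK.
  + exact/f_coer/lt_sup.
  + exact: pr.
  + exact/f_int/inf_lt/ltW.
  + exact: not_int.
- move=> y ydf; have [y1 Oy y3] := inK _ y dfd ydf; exact: fL.
Qed.

(** * Existence of integral curves *)

Lemma ultra_fmap (T U : Type) (g : T -> U) (F : set_system T) :
  UltraFilter F -> UltraFilter (g @ F).
Proof.
move=> FU; split; first exact: fmap_proper_filter.
move=> G GF FG; rewrite predeqE => A; split; last exact: FG.
move=> GA; have [//|nA] := in_ultra_setVsetC (g @^-1` A) FU.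
have /(filterI GA) : G (~` A) by exact: FG.
by rewrite setICr => /filter_not_empty.
Qed.

Section Peano.
Context {R : realType} {d : nat}.
Implicit Types (x y z : 'rV[R]_d).
Context (x0 : 'rV[R]_d) (G : 'rV[R]_d -> 'rV[R]_d).
Context (G1 : forall x, enorm (G x) <= 1).

Fixpoint euler (h : R) (k : nat) : 'rV[R]_d :=
  if k is k'.+1 then euler h k' + h *: G (euler h k') else x0.

Lemma euler_linear h k j (g : 'rV[R]_d) (kappa : R) : 0 < h ->
  (forall i, (i < j)%N -> enorm (G (euler h (k + i)) - g) <= kappa) ->
  enorm (euler h (k + j) - euler h k - (j%:R * h) *: g) <= j%:R * h * kappa.
Proof.
move=> h0; elim: j => [|j IH] Gk.
  by rewrite addn0 subrr add0r mul0r scale0r oppr0 enorm0 mul0r.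
rewrite addnS /=.
have -> : euler h (k + j) + h *: G (euler h (k + j)) - euler h k -
    (j.+1%:R * h) *: g = (euler h (k + j) - euler h k - (j%:R * h) *: g) +
      h *: (G (euler h (k + j)) - g).
  by apply/rowP => i; rewrite !mxE -natr1; ring.
apply: le_trans (ler_enormD _ _) _.
rewrite enormZ gtr0_norm// -natr1 2!mulrDl mul1r.
apply: lerD; first by apply: IH => i ij; apply: Gk; exact: ltnW.
by rewrite ler_pM2l// Gk.
Qed.

Lemma euler_dist h k j : 0 < h ->
  enorm (euler h (k + j) - euler h k) <= j%:R * h.
Proof.
move=> h0; have := @euler_linear h k j 0 1 h0.
by rewrite scaler0 subr0 mulr1; apply=> i _; rewrite subr0.
Qed.

(** Peano's theorem for c' = G(c), the derivative being from the right and with a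
modulus independent of time. The limit of the Euler polygons is taken along one
ultrafilter on the step numbers: by compactness it exists for all times
simultaneously, so no subsequence has to be extracted, and it inherits every
non-strict inequality. *)
Lemma peano (delta : R) : 0 < delta ->
  (forall kappa : R, 0 < kappa -> exists2 sigma, 0 < sigma &
    forall x y, eball x0 delta x -> eball x0 delta y ->
      enorm (x - y) <= sigma -> enorm (G x - G y) <= kappa) ->
  exists c : R -> 'rV[R]_d, [/\ c 0 = x0,
    forall s t : R, 0 <= s -> 0 <= t -> enorm (c s - c t) <= `|s - t| &
    forall kappa : R, 0 < kappa -> exists2 sigma, 0 < sigma &
      forall s t : R, 0 <= t -> 0 <= s -> s <= sigma -> t + s < delta ->
      enorm (c (t + s) - c t - s *: G (c t)) <= kappa * s].
Proof.
move=> delta0 Gc.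
pose h (n : nat) : R := n.+1%:R^-1.
have h0 n : 0 < h n by rewrite invr_gt0.
(* the number of Euler steps of length h n made up to time t *)
pose k n (t : R) := Num.truncn (t / h n).
pose X n t := euler (h n) (k n t).
have kh n t : 0 <= t -> (k n t)%:R * h n <= t < (k n t)%:R * h n + h n.
  move=> t0; have := truncn_itv (divr_ge0 t0 (ltW (h0 n))).
  by rewrite ler_pdivlMr// ltr_pdivrMr// -natr1 mulrDl mul1r.
have kle n s t : s <= t -> (k n s <= k n t)%N.
  by move=> st; apply: le_truncn; rewrite ler_pM2r// invr_gt0.
have [U [UU UN]] := ultraFilterLemma (F := \oo) _.
have hU e : 0 < e -> \forall n \near U, h n <= e.
  move=> e0; apply: UN; near=> n.
  by apply: ltW; near: n; exact: near_infty_natSinv_lt (PosNum e0).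
have X0 n t : 0 <= t -> enorm (X n t - x0) <= t.
  move=> t0; apply: le_trans (@euler_dist (h n) 0 (k n t) (h0 n)) _.
  by case/andP: (kh n t t0).
have Xlim (t : R) : exists p, 0 <= t ->
    forall e : R, 0 < e -> \forall n \near U, enorm (X n t - p) < e.
  have [t0|/negP t0] := boolP (0 <= t); last by exists x0.
  have cB : compact [set y | enorm (y - x0) <= t].
    apply: (compact_closed_eball (x := x0) (r := t)) => //.
    exact/closed_le_continuous/enorm_dist_continuous.
  move: cB; rewrite compact_ultra => /(_ (X ^~ t @ U) (ultra_fmap _ UU)).
  case; first by apply: (@filterE _ U) => n; exact: X0.
  move=> p [_ Xp]; exists p => _ e e0; apply: (Xp (eball p e)).
  by apply/nbhs_eballP; exists e.
have [c cX] := choice Xlim.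
have cnear (e s t : R) : 0 < e -> 0 <= s -> 0 <= t -> exists n,
    [/\ enorm (X n s - c s) < e, enorm (X n t - c t) < e & h n <= e].
  move=> e0 s0 t0; apply: (@filter_ex _ U).
  by apply: filterS3 (cX s s0 e e0) (cX t t0 e e0) (hU e e0) => n *; split.
have XL (n : nat) (s t : R) : 0 <= s -> s <= t ->
    enorm (X n t - X n s) <= t - s + h n.
  move=> s0 st; have t0 := le_trans s0 st.
  have := @euler_dist (h n) (k n s) (k n t - k n s) (h0 n).
  rewrite subnKC ?kle// => /le_trans; apply.
  rewrite natrB ?kle// mulrBl.
  by have /andP[? ?] := kh n t t0; have /andP[? ?] := kh n s s0; lra.
have cL (s t : R) : 0 <= s -> s <= t -> enorm (c t - c s) <= t - s.
  move=> s0 st; apply/ler_addgt0Pr => e e0; have t0 := le_trans s0 st.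
  have [|n [ns nt hn]] := cnear (e / 3) s t _ s0 t0; first by rewrite divr_gt0.
  have := XL n s t s0 st.
  have := ler_enorm_dist (X n t) (c t) (c s).
  have := ler_enorm_dist (X n s) (X n t) (c s).
  rewrite (enorm_distC (c t) (X n t)); lra.
have c0 : c 0 = x0.
  apply/eqP; rewrite -subr_eq0 -normr_le0; apply: le_trans (norm_le_enorm _) _.
  apply/ler_addgt0Pr => e e0; rewrite add0r.
  have [n [ns _ hn]] := cnear e 0 0 e0 (lexx _) (lexx _).
  have := ler_enorm_dist (X n 0) (c 0) x0; rewrite (enorm_distC (c 0) (X n 0)).
  by have := X0 n 0 (lexx _); lra.
exists c; split => //.
- move=> s t s0 t0; have [st|/ltW ts] := leP s t.
    by rewrite enorm_distC distrC ger0_norm ?subr_ge0//; exact: cL.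
  by rewrite ger0_norm ?subr_ge0//; exact: cL.
- move=> kappa kappa0; have [sigma sigma0 Gs] := Gc kappa kappa0.
  exists (sigma / 3); first by rewrite divr_gt0.
  move=> s t t0 s0 ss tsd; have ts0 : 0 <= t + s by rewrite addr_ge0.
  apply/ler_addgt0Pr => e e0.
  pose e1 := Num.min (sigma / 3) (e / (3 + kappa)).
  have k3 : 0 < 3 + kappa by lra.
  have e10 : 0 < e1 by rewrite lt_min !divr_gt0.
  have e1s : e1 <= sigma / 3 by rewrite ge_min lexx.
  have e1e : e1 * (3 + kappa) <= e by rewrite -ler_pdivlMr// ge_min lexx orbT.
  have [n [nt nts hn]] := cnear e1 t (t + s) e10 t0 ts0.
  have kts : (k n t <= k n (t + s)%R)%N by apply: kle; rewrite lerDl.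
  pose j := (k n (t + s)%R - k n t)%N.
  have kj : (k n t + j)%N = k n (t + s) by rewrite subnKC.
  have jh : `|j%:R * h n - s| <= e1.
    rewrite natrB// mulrBl ler_norml.
    have /andP[? ?] := kh n t t0; have /andP[? ?] := kh n (t + s) ts0.
    by apply/andP; split; lra.
  have /= lin := @euler_linear (h n) (k n t) j (G (c t)) kappa (h0 n) _.
  have {lin} : enorm (X n (t + s) - X n t - (j%:R * h n) *: G (c t)) <=
      j%:R * h n * kappa.
    rewrite /X -kj; apply: lin => i ij.
    have ih : i%:R * h n <= j%:R * h n by rewrite ler_pM2r// ler_nat ltnW.
    have cX_i := @euler_dist (h n) (k n t) i (h0 n).
    apply: Gs.
    - have := @euler_dist (h n) 0 (k n t + i) (h0 n).
      rewrite /eball /= add0n natrD mulrDl => /le_lt_trans; apply.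
      have /andP[+ _] := kh n (t + s) ts0; rewrite -kj natrD mulrDl; lra.
    - rewrite /eball /= -c0; have := cL 0 t (lexx 0) t0; lra.
    - have := ler_enorm_dist (X n t) (euler (h n) (k n t + i)) (c t).
      move: jh; rewrite ler_norml => /andP[]; rewrite /X in nt *; lra.
  move=> lin; have := ler_enormD (X n (t + s) - X n t - (j%:R * h n) *: G (c t))
    ((c (t + s) - X n (t + s)) + (X n t - c t) + (j%:R * h n - s) *: G (c t)).
  have -> : X n (t + s) - X n t - (j%:R * h n) *: G (c t) +
     ((c (t + s) - X n (t + s)) + (X n t - c t) + (j%:R * h n - s) *: G (c t)) =
     c (t + s) - c t - s *: G (c t).
    by apply/rowP => i; rewrite !mxE; ring.
  have := ler_enormD ((c (t + s) - X n (t + s)) + (X n t - c t))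
    ((j%:R * h n - s) *: G (c t)).
  have := ler_enormD (c (t + s) - X n (t + s)) (X n t - c t).
  rewrite (enorm_distC (c (t + s)) (X n (t + s))) enormZ.
  have : `|j%:R * h n - s| * enorm (G (c t)) <= e1.
    by apply: le_trans jh; rewrite ler_piMr.
  have : j%:R * h n * kappa <= (s + e1) * kappa.
    by rewrite ler_pM2r//; move: jh; rewrite ler_norml => /andP[]; lra.
  lra.
Unshelve. all: by end_near. Qed.

End Peano.

(** * Descent along integral curves of the inner normal *)

Section Descent.
Context {R : realType} {d : nat}.
Implicit Types (x y z m n : 'rV[R]_d) (r : R) (f : 'rV[R]_d -> \bar R).

(** Take y near x with difference quotient above a, and m its normal. By
ball_normal_angle, moving from x by s along - n brings the squared distance to
the centre y - r m of the ball at y down to r^2 + rho^2 + s^2 - 2 r (s - rho) at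
most, where rho = |x - y|. For s = (1 + k) rho the linear gain 2 r k rho
dominates the quadratic terms and the deviation of the curve from its tangent,
so the curve is in the ball at time s, where f is at most f y. *)
Lemma descent_along_normal f r x n (g : R -> 'rV[R]_d) (rho0 : R) :
  0 < r -> 0 < rho0 -> (forall y, f y <> -oo%E) -> f x \is a fin_num ->
  ball_normal f r x n ->
  (forall y, eball x rho0 y -> exists m, ball_normal f r y m) ->
  (forall kappa : R, 0 < kappa -> exists2 sigma, 0 < sigma &
    forall s : R, 0 <= s -> s <= sigma ->
      enorm (g s - x + s *: n) <= kappa * s) ->
  forall a k e : R, 0 <= a -> (a%:E < slope f x)%E ->
  0 < k -> k <= 1 -> 0 < e ->
  exists s, [/\ 0 < s, s < e & (f (g s) + (a / (1 + k) * s)%:E <= f x)%E].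
Proof.
move=> r0 rho00 fNy fx xn yn gx a k e a0 ax k0 k1 e0.
(* As s <= 2 rho, a deviation of k/8 s costs at most r k rho / 2, and rho below
   r k / 10 bounds rho^2 + s^2 <= 5 rho^2 by the same amount: half of the gain. *)
have [sigma sigma0 gs] := gx (k / 8) ltac:(lra).
pose rho1 := Num.min (Num.min rho0 (e / 2)) (Num.min (sigma / 2) (r * k / 10)).
have rho10 : 0 < rho1 by rewrite !lt_min rho00 !divr_gt0// mulr_gt0.
have fxlt : (f x < +oo)%E by rewrite ltey_eq fx.
have [y [xy yx fy]] := slope_gt_exists a0 rho10 fxlt (fNy x) ax.
have : enorm (x - y) < rho1 by rewrite enorm_distC.
rewrite /rho1 !lt_min => /andP[/andP[yrho ye] /andP[ysig yr]].
have [m ym] : exists m, ball_normal f r y m.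
  by apply: yn; rewrite /eball /= enorm_distC.
have rho_gt0 : 0 < enorm (x - y) by rewrite enorm_gt0 subr_eq0 eq_sym.
set rho := enorm (x - y) in fy yrho ye ysig yr rho_gt0 *.
pose s := (1 + k) * rho.
have s0 : 0 < s by rewrite mulr_gt0//; lra.
have s2 : s <= 2 * rho by rewrite /s; nra.
exists s; split => //; first lra.
have arho : 0 <= a * rho by rewrite mulr_ge0// ltW.
have fyx : (f y <= f x)%E.
  by apply: le_trans (ltW fy); rewrite leeDl// lee_fin.
have -> : a / (1 + k) * s = a * rho.
  by rewrite /s mulrA divfK// gt_eqF//; lra.
apply: le_trans (ltW fy); rewrite leeD2r//.
have [m1 _ ymb] := ym; have [n1 _ _] := xn.
apply: ymb; rewrite /eball /=.
have gsk : enorm (g s - x + s *: n) <= k / 8 * s by apply: gs; lra.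
have -> : g s - (y - r *: m) = (g s - x + s *: n) + ((x - y) + r *: m - s *: n).
  by apply/rowP => i; rewrite !mxE; ring.
apply: le_lt_trans (ler_enormD _ _) _.
have ks : k / 8 * s <= rho / 4 by nra.
have kr : r * k / 10 <= r / 10 by nra.
suff : enorm ((x - y) + r *: m - s *: n) < r - k / 8 * s by lra.
rewrite enorm_lt; last by lra.
have := ball_normal_angle r0 xn ym fyx.
have := cauchy_schwarz (x - y) m; rewrite m1 mulr1.
have vv : dotv (x - y) (x - y) = rho ^+ 2 by rewrite -sqr_enorm.
have mm : dotv m m = 1 by rewrite -sqr_enorm m1 expr1n.
have nn : dotv n n = 1 by rewrite -sqr_enorm n1 expr1n.
move: vv; rewrite -/rho; generalize (x - y) => v vv vm vn.
rewrite !dotvE vv mm nn (dotvC m v) (dotvC n v) (dotvC n m).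
have h1 : s * (r * (1 - dotv m n)) <= s * dotv v n by rewrite ler_pM2l.
have h2 : r * dotv v m <= r * rho by rewrite ler_pM2l.
have h3 : rho * rho <= rho * (r * k / 10) by rewrite ler_pM2l// ltW.
have h4 : s ^+ 2 <= 4 * (rho * rho) by nra.
have h5 : r * (k / 8 * s) <= r * (k / 8 * (2 * rho)).
  by rewrite ler_pM2l// ler_pM2l//; lra.
have h6 : 0 < r * k * rho by rewrite !mulr_gt0.
have h7 : 0 <= (k / 8 * s) ^+ 2 by exact: sqr_ge0.
have h8 : r * s = r * rho + r * k * rho by rewrite /s; ring.
have h9 : (r - k / 8 * s) ^+ 2 =
    r ^+ 2 - 2 * (r * (k / 8 * s)) + (k / 8 * s) ^+ 2.
  by ring.
rewrite h9; lra.
Qed.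

Lemma derivable_right (F : R -> R) (t : R) : derivable F t 1 ->
  forall e : R, 0 < e -> exists2 eta, 0 < eta & forall s, 0 < s -> s < eta ->
    `|F (t + s) - F t - s * derive1 F t| <= e * s.
Proof.
move=> dF e e0; move: (dF) => /cvgrPdist_le /(_ e e0).
move=> [eta /= eta0 near0]; exists eta => // s s0 seta.
have := near0 s; rewrite /ball_ /= sub0r normrN gtr0_norm// => /(_ seta).
rewrite gt_eqF// => /(_ isT).
rewrite -/(derive F t 1) -derive1E.
rewrite -(@ler_pM2l _ s)// -[X in X * _ <= _]gtr0_norm// -normrM => h.
rewrite -normrN [leRHS]mulrC; apply: le_trans h.
rewrite le_eqVlt; apply/orP; left; apply/eqP; congr (`| _ |).
rewrite mulrBr [_ *: (_ - _)]/(_ * _) mulrA mulfV ?gt_eqF// mul1r.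
by rewrite [s *: 1]mulr1 (addrC s t); ring.
Qed.

(** The derivative D exists, so it can be computed along any times s tending to
0. Those of descent_along_normal give D <= - a / (1 + k) for all a below the
slope and all small k. Conversely g (t + s) is a point at distance at most s
from g t, with difference quotient at least - D up to a small error. *)
Lemma slope_along_curve f r (g : R -> 'rV[R]_d) (t l T rho0 : R) n :
  0 < r -> 0 < rho0 -> (forall y, f y <> -oo%E) -> f (g t) \is a fin_num ->
  ball_normal f r (g t) n ->
  (forall y, eball (g t) rho0 y -> exists m, ball_normal f r y m) ->
  0 < l -> (l%:E < slope f (g t))%E -> t < T ->
  (forall s, t <= s -> s <= T -> f (g s) \is a fin_num) ->
  (forall s, t <= s -> s <= T -> enorm (g s - g t) <= s - t) ->
  (forall kappa : R, 0 < kappa -> exists2 sigma, 0 < sigma &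
    forall s : R, 0 <= s -> s <= sigma ->
      enorm (g (t + s) - g t + s *: n) <= kappa * s) ->
  derivable (fine \o (f \o g)) t 1 ->
  (derive1 (fine \o (f \o g)) t)%:E = (- slope f (g t))%E.
Proof.
move=> r0 rho00 fNy fx xn yn l0 lx tT ffin gL gx dF.
set F := fine \o (f \o g) in dF *; set D := derive1 F t.
have right_D := derivable_right dF.
have fE s : t <= s -> s <= T -> f (g s) = (F s)%:E.
  by move=> ts sT; rewrite /F /= fineK// ffin.
have fxE : f (g t) = (F t)%:E by rewrite /F /= fineK.
have D_le (a : R) : 0 <= a -> (a%:E < slope f (g t))%E -> D <= - a.
  move=> a0 ax.
  have Dk k : 0 < k -> k <= 1 -> D <= - (a / (1 + k)).
    move=> k0 k1; apply/ler_addgt0Pr => e e0.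
    have [eta eta0 Feta] := right_D e e0.
    have Te : 0 < Num.min eta (T - t) by rewrite lt_min eta0 subr_gt0.
    have [s [s0 + fs]] :=
      descent_along_normal r0 rho00 fNy fx xn yn gx a0 ax k0 k1 Te.
    rewrite lt_min => /andP[seta sT].
    have := Feta s s0 seta; rewrite -/D ler_norml => /andP[h _].
    move: fs; rewrite fxE fE ?lerDl ?(ltW s0)//; last by lra.
    rewrite -EFinD lee_fin => fs.
    rewrite -(@ler_pM2l _ s)//; lra.
  have D1 := Dk 1 ltr01 (lexx 1).
  apply/ler_addgt0Pr => e e0.
  pose k := Num.min 1 (e / (1 - D)).
  have D0 : D <= 0 by apply: le_trans D1 _; rewrite oppr_le0 divr_ge0//; lra.
  have k0 : 0 < k by rewrite lt_min ltr01 divr_gt0//; lra.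
  have k1 : k <= 1 by rewrite ge_min lexx.
  have kD : k * (1 - D) <= e by rewrite -ler_pdivlMr ?ge_min ?lexx ?orbT//; lra.
  have := Dk k k0 k1; rewrite -mulNr ler_pdivlMr; last by lra.
  lra.
have Dl : D <= - l by apply: D_le => //; exact: ltW.
have slope_D : ((- D)%:E <= slope f (g t))%E.
  apply/lee_subgt0Pr => e e0; rewrite -EFinB.
  wlog el : e e0 / e <= l.
    move=> hw; pose e' := Num.min e l.
    have e'0 : 0 < e' by rewrite lt_min e0.
    have := hw e' e'0; rewrite ge_min lexx orbT => /(_ isT); apply: le_trans.
    by rewrite lee_fin lerB// ge_min lexx.
  apply: slope_ge => // e1 e10.
  have [eta eta0 Feta] := right_D (e / 2) ltac:(lra).
  pose s := Num.min (Num.min (eta / 2) (T - t)) (e1 / 2).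
  have /and3P[seta sT se1] : [&& s <= eta / 2, s <= T - t & s <= e1 / 2].
    by rewrite !ge_min !lexx ?orbT.
  have s0 : 0 < s by rewrite !lt_min subr_gt0 tT !divr_gt0.
  have := Feta s s0 ltac:(lra); rewrite -/D ler_norml => /andP[_ h].
  have gts : enorm (g (t + s) - g t) <= s.
    by apply: le_trans (gL _ _ _) _; lra.
  have es : e / 2 * s <= l / 2 * s by rewrite ler_pM2r//; lra.
  have Ds : D * s <= - l * s by rewrite ler_pM2r.
  have ls : 0 < l * s by rewrite mulr_gt0.
  exists (g (t + s)); split.
  - by rewrite /eball /=; lra.
  - apply/eqP => gE; have : F (t + s) = F t by rewrite /F /= gE.
    lra.
  - rewrite fxE fE; [|by lra|by lra].
    rewrite -EFinD lee_fin enorm_distC.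
    have : (- D - e) * enorm (g (t + s) - g t) <= (- D - e) * s.
      by apply: ler_wpM2l => //; lra.
    have : 0 < e * s by rewrite mulr_gt0.
    lra.
have slope_fin : slope f (g t) = (- D)%:E.
  apply/eqP; rewrite eq_le slope_D andbT leNgt; apply/negP => Ds.
  case sE : (slope f (g t)) Ds slope_D => [v||] //.
  - rewrite lte_fin => Dv _.
    have := D_le ((v - D) / 2).
    by rewrite sE lte_fin => /(_ ltac:(lra) ltac:(lra)); lra.
  - move=> _ _; have := D_le (1 - D).
    by rewrite sE ltry => /(_ ltac:(lra) isT); lra.
by rewrite slope_fin EFinN oppeK.
Qed.

End Descent.

(** The integral curve of the opposite normal. Along it f is Lipschitz, so that
f o c has a derivative at almost every time. *)
Lemma normal_flow_steepest_descent (R : realType) (d : nat)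
    (f : 'rV[R]_d -> \bar R) (x0 : 'rV[R]_d) (delta r l L : R) :
  (forall x, f x <> -oo%E) -> 0 < delta -> 0 < r -> 0 < l ->
  (forall x, eball x0 delta x ->
    [/\ f x \is a fin_num, (l%:E < slope f x)%E,
        exists n, ball_normal f r x n &
        forall y, eball x0 delta y ->
          `|fine (f x) - fine (f y)| <= L * enorm (x - y)]) ->
  exists c : R -> 'rV[R]_d, steepest_descent_curve f x0 (delta / 2) c.
Proof.
move=> fNy delta0 r0 l0 reg.
(* peano asks for a globally bounded field; outside the ball it is set to 0 *)
have normal x : exists n,
    (eball x0 delta x -> ball_normal f r x n) /\ enorm n <= 1.
  have [xd|nxd] := pselect (eball x0 delta x); last first.
    by exists 0; rewrite enorm0; split.
  have [_ _ [n xn] _] := reg x xd.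
  by exists n; split => //; case: xn => ->.
have [N NP] := choice normal.
have [|kappa k0|c [c0 cL cG]] := @peano R d x0 (fun x => - N x) _ delta delta0.
- by move=> x; rewrite enormN; case: (NP x).
- exists (r * kappa ^+ 2 / 2); first by rewrite divr_gt0// mulr_gt0// exprn_gt0.
  move=> x y xd yd xy; rewrite -opprD enormN.
  have := ball_normal_holder r0 ((NP x).1 xd) ((NP y).1 yd).
  move=> h; have : enorm (N x - N y) ^+ 2 <= kappa ^+ 2.
    by rewrite -(ler_pM2l r0); lra.
  by rewrite ler_pXn2r// nnegrE ?enorm_ge0 ?ltW.
set T := delta / 2; have T0 : 0 < T by rewrite divr_gt0.
have cd (s : R) : 0 <= s -> s <= T -> eball x0 delta (c s).
  move=> s0 sT; rewrite /eball /= -{1}c0.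
  apply: le_lt_trans (cL s 0 s0 (lexx _)) _.
  by rewrite subr0 ger0_norm//; rewrite /T in sT; lra.
(* clamping time to [0, T] makes f o c Lipschitz on the whole line *)
pose clamp (s : R) := Num.max 0 (Num.min s T).
have clamp_itv s : 0 <= clamp s /\ clamp s <= T.
  split; first by rewrite /clamp le_max lexx.
  by rewrite /clamp ge_max (ltW T0)/= ge_min lexx orbT.
have clampE s : 0 <= s -> s <= T -> clamp s = s.
  by move=> s0 sT; rewrite /clamp min_l// max_r.
have clampB s t : s <= t -> 0 <= clamp t - clamp s <= t - s.
  rewrite /clamp => st.
  by case: (leP s T) => ?; case: (leP t T) => ?; case: (leP 0 s) => ?;
    case: (leP 0 t) => ?; case: (leP 0 T) => ?; apply/andP; split; lra.
have clampL s t : `|clamp s - clamp t| <= `|s - t|.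
  wlog st : s t / s <= t => [hw|].
    have [|/ltW] := leP s t; first exact: hw.
    by rewrite distrC (distrC s); exact: hw.
  have /andP[h1 h2] := clampB s t st.
  by rewrite distrC (distrC s) !ger0_norm// (le_trans h1).
pose F s := fine (f (c (clamp s))).
have FL s t : `|F s - F t| <= Num.max L 0 * `|s - t|.
  have [s0 sT] := clamp_itv s; have [t0 tT] := clamp_itv t.
  have [_ _ _ /(_ _ (cd _ t0 tT)) h] := reg _ (cd _ s0 sT).
  apply: le_trans h _.
  apply: (@le_trans _ _ (Num.max L 0 * enorm (c (clamp s) - c (clamp t)))).
    by rewrite ler_wpM2r ?enorm_ge0// le_max lexx.
  rewrite ler_wpM2l ?le_max ?lexx ?orbT//.
  by apply: le_trans (cL _ _ s0 t0) (clampL s t).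
exists c; split => //.
  by move=> s t; rewrite !in_itv/= => /andP[s0 _] /andP[t0 _]; exact: cL.
have ae0 (a : R) : {ae (@lebesgue_measure R), forall t, t != a}.
  exists [set a]; split.
  - exact: measurable_set1.
  - exact: lebesgue_measure_set1.
  - by move=> t /= /negP; rewrite negbK => /eqP.
have := lipschitz_ae_derivable 0 T FL.
have aeF : Filter (nbhs (almost_everywhere (@lebesgue_measure R))).
  exact: (ae_filter_ringOfSetsType (@lebesgue_measure R)).
apply: filterS3 (ae0 0) (ae0 T) => t tn0 tnT dF.
rewrite in_itv/= => /andP[]; rewrite le_eqVlt eq_sym (negbTE tn0)/= => t0.
rewrite le_eqVlt (negbTE tnT)/= => tT.
have near_itv : \forall s \near t, 0 < s /\ s < T.
  by apply: filterI; [exact: lt_nbhsr|exact: lt_nbhsl].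
have FE : {near t, F =1 fine \o (f \o c)}.
  by apply: filterS near_itv => s [s0 sT]; rewrite /F /= clampE ?ltW.
have dfc : derivable (fine \o (f \o c)) t 1.
  by apply: near_eq_derivable FE _; apply: dF; rewrite in_itv/= t0 tT.
have fin s : 0 <= s -> s <= T -> f (c s) \is a fin_num.
  by move=> s0 sT; have [] := reg _ (cd s s0 sT).
split => //.
  by apply: filterS near_itv => s [s0 sT]; apply: fin; exact: ltW.
have ctd := cd t (ltW t0) (ltW tT).
have [_ sl _ _] := reg _ ctd.
apply: (@slope_along_curve _ _ f r c t l T (delta - enorm (c t - x0))
  (N (c t))) => //.
- by rewrite subr_gt0.
- exact: fin (ltW t0) (ltW tT).
- exact: (NP _).1.
- move=> y yd; have yx0 : eball x0 delta y.
    rewrite /eball /=; have := ler_enorm_dist (c t) y x0.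
    by move: yd; rewrite /eball /=; lra.
  by have [_ _ ? _] := reg y yx0.
- by move=> s ts; apply: fin; apply: le_trans ts; exact: ltW.
- move=> s ts _; have s0 := le_trans (ltW t0) ts.
  by have := cL s t s0 (ltW t0); rewrite (ger0_norm (x := s - t)) ?subr_ge0.
- move=> kappa k0; have [sigma sigma0 sc] := cG kappa k0.
  exists (Num.min sigma (delta / 4)); first by rewrite lt_min sigma0 divr_gt0.
  move=> s s0; rewrite le_min => /andP[ssig sd].
  have := sc s t (ltW t0) s0 ssig; rewrite scalerN opprK; apply.
  by move: tT; rewrite /T; lra.
Qed.

Lemma steepest_descent_curve_argmin (R : realType) (d : nat)
    (f : 'rV[R]_d -> \bar R) x :
  (0 < d)%N -> (forall y, f y <> -oo%E) -> (f x < +oo)%E -> argmin f x ->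
  steepest_descent_curve f x 1 (cst x).
Proof.
move=> d0 fNy fx xmin.
have fxfin : f x \is a fin_num.
  by rewrite fin_numE; apply/andP; split; [exact/eqP|rewrite lt_eqF].
split=> // [s t _ _|]; first by rewrite subrr enorm0.
apply: aeW => t _; split; first by apply: filterE => s.
- exact: (@derivable_cst _ _ _ (fine (f x))).
- rewrite (_ : fine \o _ = cst (fine (f x)))// derive1_cst.
  by rewrite slope_argmin// oppe0.
Qed.

(** Degenerate boxes have volume 0 in positive dimension; in dimension 0 the
empty product makes every box have volume 1. *)
Lemma lebesgue_outer0 (R : realType) (d : nat) : (0 < d)%N ->
  lebesgue_outer (set0 : set 'rV[R]_d) = 0%E.
Proof.
move=> d0; apply/eqP; rewrite eq_le; apply/andP; split.
  apply: ereal_inf_lbound; exists (fun=> 0), (fun=> 0); split => //.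
  rewrite eseries0// => i _ _; congr EFin.
  by rewrite /box_volume (bigD1 (Ordinal d0))//= subrr maxxx mul0r.
apply: le_ereal_inf_tmp => _ [a [b [_ ->]]].
apply: nneseries_ge0 => i _ _; rewrite lee_fin.
by apply: prodr_ge0 => j _; rewrite le_max lexx.
Qed.

Theorem theorem3p9 (R : realType) (d : nat) (hd : (0 < d)%N)
  (f : 'rV[R]_d -> \bar R) (O : set 'rV[R]_d)
  (f_ninfty : forall x, f x <> -oo%E)
  (f_lsc : lower_semicontinuous f)
  (f_qcvx : quasiconvex f)
  (f_cont : forall x, (dom f)° x -> {for x, continuous f})
  (O_open : open O)
  (O_dom : O `<=` dom f)
  (f_lip : locally_lipschitz_on f O)
  (ha : coercive f /\
        forall a : R, (inf_fun f < a%:E)%E -> (sublevel f a)° !=set0)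
  (hb : forall x, (dom f `\` argmin f) x ->
        exists delta l : R, [/\ 0 < delta, 0 < l &
          forall y, (eball x delta `&` dom f) y -> (l%:E < slope f y)%E])
  (hc : forall a : R, (inf_fun f < a%:E)%E -> (a%:E < sup_fun f)%E ->
        exists eta r : R, [/\ 0 < eta, 0 < r &
          forall b : R, a - eta < b -> b < a + eta ->
            prox_regular r (~` (sublevel f b)°)]) :
  ae_on O (fun x => exists (T : R) (c : R -> 'rV[R]_d),
    0 < T /\ steepest_descent_curve f x T c).
Proof.
rewrite /ae_on (_ : O `\` _ = set0) ?lebesgue_outer0//.
rewrite -subset0 => x [Ox]; apply => /=.
have [xmin|xmin] := pselect (argmin f x).
  exists 1, (cst x); split=> //.
  by apply: steepest_descent_curve_argmin => //; exact: O_dom.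
have [delta [r [l [L [delta0 r0 l0 reg]]]]] :=
  regular_neighborhood f_ninfty f_qcvx O_open O_dom f_lip ha.1 ha.2 hb hc
    Ox xmin.
have [c fc] := normal_flow_steepest_descent f_ninfty delta0 r0 l0 reg.
by exists (delta / 2), c; rewrite divr_gt0.
Qed.
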